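(* Let $p,q$ be relatively prime integers and assume that $p$ is a prime. Then the function $$\mathfrak s\mapsto d(L(p,q),\mathfrak s):\ \frac{Spin^{\mathbb C}(L(p,q))}{\mathbb Z/2\mathbb Z}\to\mathbb Q$$ is injective, where $\mathbb Z/2\mathbb Z$ acts on $Spin^{\mathbb C}(L(p,q))$ by conjugation $\mathfrak s\mapsto\bar{\mathfrak s}$. Additionally, if $p$ is odd, the only possible vanishing correction term of $L(p,q)$ is the one associated to the unique spin-structure of $L(p,q)$.
   Context: Heegaard Floer correction terms. For a rational homology $3$-sphere $Y$ with a spin$^{\mathbb C}$-structure $\mathfrak s$, $d(Y,\mathfrak s)\in\mathbb Q$ denotes the Heegaard Floer correction term of Ozsváth and Szabó; it is invariant under conjugation, $d(Y,\bar{\mathfrak s})=d(Y,\mathfrak s)$, so it descends to the quotient of $Spin^{\mathbb C}(Y)$ by conjugation. For $p$ odd, $L(p,q)$ has a unique spin-structure, and the spin$^{\mathbb C}$-structure it induces is the unique self-conjugate one. For $p>0$ the set $Spin^{\mathbb C}(L(p,q))$ of the lens space $L(p,q)$ (oriented so that it is $p/q$-surgery on the unknot in $S^3$) is identified with $H^2(L(p,q);\mathbb Z)\cong\mathbb Z/p\mathbb Z$ by the Ozsváth–Szabó labelling, and one writes $d(L(p,q),n)$ for $n\in\mathbb Z/p\mathbb Z$; in this labelling conjugation is $n\mapsto q-1-n \pmod p$. For $p>0$ these numbers depend on $q$ and $n$ only modulo $p$ (since $L(p,q+kp)\cong L(p,q)$ for $k\in\mathbb Z$), satisfy $d(L(1,1),0)=0$,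 and by a theorem of Ozsváth and Szabó satisfy, for all relatively prime $0<q<p$ and $0\le n<p+q$, $$d(L(p,q),n)+d(L(q,p),n)=\frac14+\frac{n^2}{pq}+n\left(\frac1{pq}-\frac1q-\frac1p\right)+\frac14\left(\frac pq+\frac1{pq}+\frac qp\right)-\frac1{2q}-\frac1{2p}.$$ These properties determine all $d(L(p,q),n)$ for relatively prime $p>0$ and $q$. *)

(* Defs.v *)
From HB Require Import structures.
From mathcomp Require Import all_boot all_order all_algebra.
From mathcomp Require Import generic_quotient zify ring lra.

Set Implicit Arguments.
Unset Strict Implicit.
Unset Printing Implicit Defensive.

Import Order.TTheory GRing.Theory Num.Theory.
Local Open Scope ring_scope.

(* Right-hand side of the Ozsvath-Szabo reciprocity
   d(L(p,q),n) + d(L(q,p),n) = os_rhs p q n   (0 < q < p, 0 <= n < p + q). *)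
Definition os_rhs (p q n : rat) : rat :=
  1 / 4 + n ^+ 2 / (p * q) + n * (1 / (p * q) - 1 / q - 1 / p)
  + 1 / 4 * (p / q + 1 / (p * q) + q / p) - 1 / (2 * q) - 1 / (2 * p).

(* The Euclidean recursion given by the reciprocity, for q, n already reduced
   modulo p; the argument [k] is fuel, and p <= k is enough. *)
Fixpoint lens_d_rec (k p q n : nat) : rat :=
  if k is k'.+1 then
    if (p <= 1)%N then 0
    else os_rhs p%:R q%:R n%:R - lens_d_rec k' q (p %% q) (n %% q)
  else 0.

(* The correction term d(L(p,q),n) for p > 0 and q prime to p, where L(p,q) is
   p/q-surgery on the unknot and the label n is an integer read modulo p.
   Heegaard Floer homology is not available; [lens_dP] and [lens_d_unique] show
   that, for such p and q, this is the only function with the properties of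
   [correction_term_spec], which are known for the correction terms of lens
   spaces. *)
Definition lens_d (p : nat) (q n : int) : rat :=
  lens_d_rec p p `|(q %% p)%Z| `|(n %% p)%Z|.

Record correction_term_spec (d : nat -> int -> int -> rat) : Prop := {
  ct_q_mod : forall (p : nat) (q n k : int), (0 < p)%N -> coprimez p q ->
    d p (q + k * p) n = d p q n;
  ct_n_mod : forall (p : nat) (q n k : int), (0 < p)%N -> coprimez p q ->
    d p q (n + k * p) = d p q n;
  ct_sphere : d 1%N 1 0 = 0;
  ct_conj : forall (p : nat) (q n : int), (0 < p)%N -> coprimez p q ->
    d p q (q - 1 - n) = d p q n;
  ct_reciprocity : forall p q n : nat, (0 < q < p)%N -> coprime p q ->
    (n < p + q)%N -> d p q n + d q p n = os_rhs p%:R q%:R n%:R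
}.

(* Spin^c(L(p,q)) with the Ozsvath-Szabo labelling is 'Z_p.  This is right only
   for p > 1, since 'Z_1 is the ring of integers modulo 2. *)
Definition spinc_d (p : nat) (q : int) (s : 'Z_p) : rat :=
  lens_d p q (nat_of_ord s).

Definition spinc_conj (p : nat) (q : int) (s : 'Z_p) : 'Z_p := q%:~R - 1 - s.

(* The Spin^c structures induced by a spin structure are those with trivial
   first Chern class, that is, the self-conjugate ones. *)
Definition from_spin (p : nat) (q : int) (s : 'Z_p) : Prop :=
  spinc_conj q s = s.

Lemma spinc_conjK p q : involutive (@spinc_conj p q).
Proof. by move=> s; rewrite /spinc_conj subKr. Qed.

(* The orbit relation of the action of Z/2 by conjugation. *)
Definition conj_rel (p : nat) (q : int) : rel 'Z_p :=
  fun s t => (t == s) || (t == spinc_conj q s).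

Lemma conj_rel_refl p q : reflexive (@conj_rel p q).
Proof. by move=> s; rewrite /conj_rel eqxx. Qed.

Lemma conj_rel_sym p q : symmetric (@conj_rel p q).
Proof.
move=> s t; rewrite /conj_rel [s == t]eq_sym; congr (_ || _).
by rewrite -(inj_eq (can_inj (@spinc_conjK p q))) spinc_conjK eq_sym.
Qed.

Lemma conj_rel_trans p q : transitive (@conj_rel p q).
Proof.
move=> t s u /orP[] /eqP-> // /orP[] /eqP->; rewrite /conj_rel.
  by rewrite eqxx orbT.
by rewrite spinc_conjK eqxx.
Qed.

Canonical conj_equiv p q :=
  EquivRel (@conj_rel p q) (@conj_rel_refl p q) (@conj_rel_sym p q)
    (@conj_rel_trans p q).

Definition spinc_mod_conj (p : nat) (q : int) : Type :=
  {eq_quot @conj_rel p q}%qT.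

HB.instance Definition _ p q := Choice.on (spinc_mod_conj p q).
HB.instance Definition _ p q :=
  EqQuotient.on (spinc_mod_conj p q).

(* The descent of [spinc_d] to the quotient; [spinc_dbar_pi] shows that it does
   not depend on the chosen representatives. *)
Definition spinc_dbar p q (x : spinc_mod_conj p q) : rat :=
  spinc_d q (repr x).

Lemma os_rhsE (p q n : rat) : p != 0 -> q != 0 ->
  os_rhs p q n = (2 * n + 1 - p - q) ^+ 2 / (4 * p * q) - 1 / 4.
Proof. by move=> p0 q0; rewrite /os_rhs; field; rewrite p0 q0. Qed.

Section NatLevel.

Let dn (p q n : nat) : rat := lens_d_rec p p (q %% p) (n %% p).

Let natr_neq0 (n : nat) : (0 < n)%N -> (n%:R : rat) != 0.
Proof. by rewrite pnatr_eq0 -lt0n. Qed.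

Lemma lens_d_rec_fuel k k' p q n : (q < p <= k)%N -> (p <= k')%N ->
  lens_d_rec k p q n = lens_d_rec k' p q n.
Proof.
elim: k k' p q n => [|k IH] [|k'] p q n; try by lia.
move=> /andP[qp pk] pk' /=; case: ifP => // p1.
case: q qp => [|q] qp; last by rewrite (IH k') ?ltn_mod //; lia.
have z j m t : lens_d_rec j 0 m t = 0 by case: j.
by rewrite !z.
Qed.

Let dn_mod p q q' n n' : q = q' %[mod p] -> n = n' %[mod p] ->
  dn p q n = dn p q' n'.
Proof. by rewrite /dn => -> ->. Qed.

Let dn1 q n : dn 1 q n = 0.
Proof. by []. Qed.

Let dn_step p q n : (0 < q < p)%N -> (n < p)%N ->
  dn p q n = os_rhs p%:R q%:R n%:R - dn q p n.
Proof.
case: p => [|p] /andP[q0 qp] np; first by [].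
rewrite {1}/dn !modn_small //= ifF; last by lia.
by congr (_ - _); apply: lens_d_rec_fuel; rewrite ?ltn_mod; lia.
Qed.

Let dn_shift p q n : (0 < p)%N -> coprime p q -> (n < p)%N ->
  dn p q (n + q) - dn p q n = (2 * n%:R + 1 - p%:R) / p%:R.
Proof.
elim/ltn_ind: p q n => p IH q n p0 cpq np.
have [p1|p1] : p = 1%N \/ (1 < p)%N by lia.
  have -> : n = 0%N by lia.
  by rewrite p1 !dn1; field.
wlog qp : q cpq / (q < p)%N.
  move=> /(_ (q %% p)%N); rewrite coprime_modr ltn_mod => /(_ cpq p0) <-.
  by congr (_ - _); apply: dn_mod; rewrite ?modn_mod ?modnDmr.
have q0 : (0 < q)%N.
  by rewrite lt0n; apply/eqP => q0; move: cpq; rewrite q0 /coprime gcdn0; lia.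
have nzp := natr_neq0 p0; have nzq := natr_neq0 q0.
have hqp : (0 < q < p)%N by rewrite q0.
have [nqp|nqp] := ltnP (n + q) p.
  rewrite (dn_step hqp nqp) (dn_step hqp np).
  rewrite (@dn_mod q p p (n + q) n) ?modnDr // !os_rhsE // natrD.
  by field; rewrite nzp nzq.
pose m := (n + q - p)%N.
have mq : (m < q)%N by rewrite /m; lia.
have Em : (n + q = m + p)%N by rewrite /m; lia.
rewrite (@dn_mod p q q (n + q) m) //; last by rewrite Em modnDr.
have mp : (m < p)%N by lia.
rewrite (dn_step hqp mp) (dn_step hqp np).
have := IH q qp p m q0; rewrite coprime_sym => /(_ cpq mq).
rewrite (@dn_mod q p p (m + p) n) //; last by rewrite -Em modnDr.
have /(congr1 (fun x : nat => x%:R : rat)) := Em; rewrite !natrD => En.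
have -> : n%:R = m%:R + p%:R - q%:R :> rat by lra.
move=> /(congr1 (fun x => x + dn q p m)); rewrite subrK => ->.
by rewrite !os_rhsE //; field; rewrite nzp nzq.
Qed.

Let dn_recip p q n : (0 < q < p)%N -> coprime p q -> (n < p + q)%N ->
  dn p q n + dn q p n = os_rhs p%:R q%:R n%:R.
Proof.
move=> hqp cpq npq; have /andP[q0 qp] := hqp.
have p0 : (0 < p)%N by lia.
have nzp := natr_neq0 p0; have nzq := natr_neq0 q0.
have [np|np] := ltnP n p; first by rewrite (dn_step hqp np) subrK.
pose m := (n - p)%N.
have mq : (m < q)%N by rewrite /m; lia.
have En : (n = m + p)%N by rewrite /m; lia.
rewrite En (@dn_mod p q q (m + p) m) ?modnDr //.
have := @dn_shift q p m q0; rewrite coprime_sym => /(_ cpq mq).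
move=> /(congr1 (fun x => x + dn q p m)); rewrite subrK => ->.
have mp : (m < p)%N by lia.
rewrite (dn_step hqp mp).
by rewrite !os_rhsE // natrD; field; rewrite nzp nzq.
Qed.

Let dn_conj p q n m : (0 < p)%N -> coprime p q ->
  (n + m).+1 = q %[mod p] -> dn p q n = dn p q m.
Proof.
elim/ltn_ind: p q n m => p IH q n m p0 cpq.
have [->|p1] : p = 1%N \/ (1 < p)%N by lia.
  by rewrite !dn1.
wlog qp : q cpq / (q < p)%N.
  move=> /(_ (q %% p)%N); rewrite coprime_modr ltn_mod modn_mod.
  move=> /(_ cpq p0) H E; rewrite (@dn_mod p q (q %% p) n n) ?modn_mod //.
  by rewrite (@dn_mod p q (q %% p) m m) ?modn_mod //; apply: H.
wlog np : n / (n < p)%N.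
  move=> /(_ (n %% p)%N); rewrite ltn_mod => /(_ p0) H E.
  rewrite (@dn_mod p q q n (n %% p)) ?modn_mod //; apply: H.
  by rewrite -addnS modnDml addnS.
have q0 : (0 < q)%N.
  by rewrite lt0n; apply/eqP => q0; move: cpq; rewrite q0 /coprime gcdn0; lia.
have nzp := natr_neq0 p0; have nzq := natr_neq0 q0.
have hqp : (0 < q < p)%N by rewrite q0.
pose l := (p + q - 1 - n)%N.
have El : ((n + l).+1 = p + q)%N by rewrite /l; lia.
move=> E; rewrite (@dn_mod p q q m l) //; last first.
  apply/eqP; rewrite -(eqn_modDl n.+1) !addSn; apply/eqP.
  by rewrite E El modnDl.
have -> : dn p q n = os_rhs p%:R q%:R n%:R - dn q p n by rewrite (dn_step hqp np).
have <- : os_rhs p%:R q%:R l%:R - dn q p l = dn p q l.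
  by rewrite -dn_recip ?addrK //; lia.
rewrite (IH q qp p n l) //; last by rewrite El modnDr.
  congr (_ - _); have /(congr1 (fun x : nat => x%:R : rat)) := El.
  rewrite -addn1 !natrD => En.
  have -> : l%:R = p%:R + q%:R - 1 - n%:R :> rat by lra.
  by rewrite !os_rhsE //; field; rewrite nzp nzq.
by rewrite coprime_sym.
Qed.

Let absz_modz (p : nat) (z : int) : (0 < p)%N ->
  (`|(z %% p)%Z|%N : int) = (z %% p)%Z.
Proof. by move=> p0; rewrite gez0_abs // modz_ge0 //; lia. Qed.

Let lens_d_dn p q n : (0 < p)%N ->
  lens_d p q n = dn p `|(q %% p)%Z| `|(n %% p)%Z|.
Proof.
move=> p0; rewrite /lens_d /dn !modn_small //.
  by rewrite -ltz_nat absz_modz // ltz_pmod.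
by rewrite -ltz_nat absz_modz // ltz_pmod.
Qed.

Let lens_d_nat (p q n : nat) : lens_d p q n = dn p q n.
Proof. by rewrite /lens_d !modz_nat. Qed.

Lemma lens_d_conj (p : nat) (q n : int) : (0 < p)%N -> coprimez p q ->
  lens_d p q (q - 1 - n) = lens_d p q n.
Proof.
move=> p0 cpq; rewrite !lens_d_dn //; apply: dn_conj => //.
  have : coprimez p (q %% p)%Z by rewrite /coprimez gcdz_modr.
  by rewrite -absz_modz //.
apply: (can_inj absz_nat); rewrite -!modz_nat -addn1 !PoszD !absz_modz //.
rewrite modz_mod -addrA modzDml addrCA modzDml.
by congr (_ %% _)%Z; ring.
Qed.

Lemma lens_dP : correction_term_spec lens_d.
Proof.
split=> //.
- by move=> p q n k p0 _; rewrite /lens_d addrC modzMDl.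
- by move=> p q n k p0 _; rewrite /lens_d addrC modzMDl.
- exact: lens_d_conj.
- by move=> p q n hqp cpq npq; rewrite !lens_d_nat dn_recip.
Qed.

End NatLevel.

Lemma lens_d_unique (d : nat -> int -> int -> rat) : correction_term_spec d ->
  forall (p : nat) (q n : int), (0 < p)%N -> coprimez p q ->
  d p q n = lens_d p q n.
Proof.
move=> hd p; have hl := lens_dP; elim/ltn_ind: p => p IH q n p0 cpq.
have red f : correction_term_spec f ->
    f p q n = f p `|(q %% p)%Z|%N `|(n %% p)%Z|%N.
  move=> hf; rewrite !gez0_abs ?modz_ge0 //; try by lia.
  have cpq' : coprimez p (q %% p)%Z by rewrite /coprimez gcdz_modr.
  rewrite -(ct_n_mod hf (n %% p)%Z (n %/ p)%Z) //.
  rewrite -(ct_q_mod hf (q := (q %% p)%Z) _ (q %/ p)%Z) //.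
  by rewrite ![((_ %% _)%Z + _)%R]addrC -!divz_eq.
rewrite (red _ hd) (red _ hl).
have : coprime p `|(q %% p)%Z|.
  by have : coprimez p (q %% p)%Z by rewrite /coprimez gcdz_modr.
have : (`|(q %% p)%Z| < p)%N by rewrite -ltz_nat gez0_abs ?modz_ge0 ?ltz_pmod //; lia.
have : (`|(n %% p)%Z| < p)%N by rewrite -ltz_nat gez0_abs ?modz_ge0 ?ltz_pmod //; lia.
move: `|(q %% p)%Z|%N `|(n %% p)%Z|%N => {}q' {}n' np qp {}cpq.
have [p1|p1] : p = 1%N \/ (1 < p)%N by lia.
  have [-> ->] : q' = 0%N /\ n' = 0%N by lia.
  have sph f : correction_term_spec f -> f 1%N 0 0 = 0.
    by move=> hf; rewrite -(ct_q_mod hf (q := 0) _ 1) // (ct_sphere hf).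
  by rewrite p1 !sph.
have q0 : (0 < q')%N.
  by rewrite lt0n; apply/eqP => q0; move: cpq; rewrite q0 /coprime gcdn0; lia.
have hqp : (0 < q' < p)%N by rewrite q0.
apply: (addIr (d q' p n')); rewrite (ct_reciprocity hd) //; last by lia.
rewrite IH //; last by rewrite /coprimez /gcdz /= eqz_nat -/(coprime q' p) coprime_sym.
by rewrite (ct_reciprocity hl) //; lia.
Qed.

Lemma val_Zp_int (p : nat) (z : int) : (1 < p)%N ->
  (nat_of_ord (z%:~R : 'Z_p) : int) = (z %% p)%Z.
Proof.
move=> p1; have r0 : (z %% p)%Z = `|(z %% p)%Z|%N :> int.
  by rewrite gez0_abs // modz_ge0 //; lia.
rewrite {1}(divz_eq z p) intrD intrM -[p%:~R]/(p%:R) pchar_Zp // mulr0 add0r.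
rewrite r0 -[_%:~R]/(_%:R) val_Zp_nat // modn_small //.
by rewrite -ltz_nat -r0 ltz_pmod //; lia.
Qed.

Lemma spinc_d_conj (p : nat) (q : int) (s : 'Z_p) : (1 < p)%N ->
  coprimez p q -> spinc_d q (spinc_conj q s) = spinc_d q s.
Proof.
move=> p1 cpq; rewrite /spinc_d -[RHS]lens_d_conj //; last by lia.
have -> : spinc_conj q s = (q - 1 - Posz (nat_of_ord s))%:~R.
  by rewrite !intrD !intrN -[(Posz s)%:~R]/(s%:R) natr_Zp.
by rewrite val_Zp_int // /lens_d modz_mod.
Qed.

Lemma spinc_dbar_pi (p : nat) (q : int) (s : 'Z_p) : (1 < p)%N ->
  coprimez p q -> spinc_dbar (\pi_(spinc_mod_conj p q)%qT s) = spinc_d q s.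
Proof.
move=> p1 cpq; rewrite /spinc_dbar.
by case: piP => t /eqmodP /orP[] /eqP-> //; rewrite spinc_d_conj.
Qed.

(* Main.v *)
(** The reciprocity at [n] and [n + q] gives
    [d(p,q,n+q) - d(p,q,n) = (2n + 1 - p)/p] for [0 <= n < p].  Iterating along
    multiples of [q], the integer [z = p (d(p,q,m) - d(p,q,n))] satisfies
    [q z = (m - n) (m + n + 1 - q)] modulo [p], and the zeros of the right-hand
    side are [m = n] and [m = q - 1 - n], the conjugate of [n].  For [p] odd, the
    reciprocity at the fixed point [n] of conjugation, where [p] divides
    [2n + 1 - q], shows that [d(p,q,n)] has denominator prime to [p], because all
    denominators occurring in [d(q,p,n)] are products of factors of 4 and of
    numbers less than [p].  If [d(p,q,m) = 0] then [p] divides [z], and [m] is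
    that fixed point. *)

Require Import Defs.
From mathcomp Require Import all_boot all_order all_algebra.
From mathcomp Require Import generic_quotient zify ring.

Set Implicit Arguments.
Unset Strict Implicit.
Unset Printing Implicit Defensive.

Import Order.TTheory GRing.Theory Num.Theory.
Local Open Scope ring_scope.

(** * Differences of correction terms *)

Lemma natr_residue (p : nat) (z : int) : (0 < p)%N ->
  exists2 r : nat, (r < p)%N & (z %% p)%Z = r.
Proof.
move=> p0; exists `|(z %% p)%Z|%N; last by rewrite gez0_abs // modz_ge0 //; lia.
by rewrite -ltz_nat gez0_abs ?modz_ge0 ?ltz_pmod //; lia.
Qed.

Lemma lens_d_mod (p : nat) (q n : int) :
  lens_d p q n = lens_d p (q %% p)%Z (n %% p)%Z.
Proof. by rewrite /lens_d !modz_mod. Qed.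

Lemma coprime_gt0r (p q : nat) : (1 < p)%N -> coprime p q -> (0 < q)%N.
Proof. by case: q => // p1; rewrite /coprime gcdn0 => /eqP; lia. Qed.

(** The residues [b] and [b + a] lie below [p + a], so reciprocity covers both, and the terms for
    L(a,p) cancel because these labels agree modulo [a]. *)
Lemma lens_d_shift (p : nat) (q n : int) : (1 < p)%N -> coprimez p q ->
  p%:R * (lens_d p q (n + q) - lens_d p q n)
    = (2 * (n %% p)%Z + 1 - p%:Z)%:~R.
Proof.
move=> p1 cpq; have p0 : (0 < p)%N by lia.
have [a ap Ea] := natr_residue q p0; have [b bp Eb] := natr_residue n p0.
have cpa : coprime p a.
  by rewrite -[coprime p a]/(coprimez p a) -Ea /coprimez gcdz_modr.
have a0 := coprime_gt0r p1 cpa.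
rewrite lens_d_mod [lens_d p q n]lens_d_mod Eb Ea -modzDm Eb Ea.
have -> : lens_d p a ((b + a)%R %% p)%Z = lens_d p a (b + a)%N.
  by rewrite /lens_d modz_mod.
have hap : (0 < a < p)%N by rewrite a0.
have R1 := ct_reciprocity lens_dP hap cpa (n := (b + a)%N) ltac:(lia).
have R2 := ct_reciprocity lens_dP hap cpa (n := b) ltac:(lia).
have cap : coprimez a p by rewrite -[coprimez a p]/(coprime a p) coprime_sym.
have := ct_n_mod lens_dP b 1 a0 cap; rewrite mul1r => E.
have {E} E : lens_d a p (b + a)%N = lens_d a p b by [].
have -> : lens_d p a (b + a)%N - lens_d p a b =
    os_rhs p%:R a%:R (b + a)%:R - os_rhs p%:R a%:R b%:R.
  by rewrite -R1 -R2 E; ring.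
have nzp : p%:R != 0 :> rat by rewrite pnatr_eq0; lia.
have nza : a%:R != 0 :> rat by rewrite pnatr_eq0; lia.
rewrite !os_rhsE // !intrD intrM intrN natrD -!pmulrn.
by field; rewrite nzp nza.
Qed.

(** Telescoping of [lens_d_shift]: [c] collects the multiples of [p] coming from the reduction of
    the labels and from the [- p] in each shift. *)
Lemma lens_d_shiftn (p : nat) (q n : int) (k : nat) : (1 < p)%N ->
  coprimez p q -> exists c : int,
    p%:R * (lens_d p q (n + q * k%:Z) - lens_d p q n)
      = (k%:Z * (2 * n + 1 + q * (k%:Z - 1)) + c * p)%:~R.
Proof.
move=> p1 cpq; elim: k => [|k [c IH]].
  by exists 0; rewrite !mulr0 addr0 subrr mulr0 !mul0r.
pose r := (n + q * k%:Z)%R.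
exists (c - 2 * (r %/ p)%Z - 1); have := lens_d_shift r p1 cpq.
have -> : r + q = n + q * k.+1%:Z by rewrite /r; lia.
have -> : (r %% p)%Z = r - (r %/ p)%Z * p by have := divz_eq r p; lia.
move=> E; rewrite -[lens_d p q (n + q * k.+1%:Z)](subrK (lens_d p q r)).
rewrite -addrA mulrDr E IH -intrD; congr (_%:~R).
have -> : k.+1%:Z = k%:Z + 1 by lia.
by rewrite /r; ring.
Qed.

Lemma lens_d_diff (p : nat) (q m n : int) : (1 < p)%N -> coprimez p q ->
  exists2 z : int, p%:R * (lens_d p q m - lens_d p q n) = z%:~R &
    (p %| (q * z)%R - (m - n) * (m + n + 1 - q))%Z.
Proof.
move=> p1 cpq; have /coprimezP [[u v] /= uv] := cpq.
(* As [v] inverts [q] modulo [p], [k] shifts by [q] lead from [n] to [m] modulo [p]. *)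
have [k _ Ek] := natr_residue (v * (m - n)) (ltnW p1).
have [c Ec] := lens_d_shiftn n k p1 cpq.
pose w := u * (m - n) + q * ((v * (m - n)) %/ p)%Z.
have Eqk : q * k%:Z = m - n - w * p.
  have -> : k%:Z = v * (m - n) - ((v * (m - n)) %/ p)%Z * p.
    by have := divz_eq (v * (m - n)) p; rewrite Ek; lia.
  by rewrite /w -[X in _ = X - _]mul1r -uv; ring.
exists (k%:Z * (2 * n + 1 + q * (k%:Z - 1)) + c * p).
  rewrite -Ec Eqk; congr (_ * (_ - _)); rewrite lens_d_mod [RHS]lens_d_mod.
  have -> : n + (m - n - w * p) = - w * p + m by ring.
  by rewrite modzMDl.
apply/dvdzP; exists (q * c - (m - n) * w - w * (m + n + 1 - w * p - q)).
(* After multiplication by [q], [k] occurs only in [q * k], which [Eqk] eliminates. *)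
have -> : q * (k%:Z * (2 * n + 1 + q * (k%:Z - 1)) + c * p)
  = q * k%:Z * (2 * n + 1 + q * k%:Z - q) + q * c * p by ring.
by rewrite Eqk; ring.
Qed.

(** * Divisibility by [p] and conjugation classes *)

Lemma prime_dvdzM (p : nat) (x y : int) : prime p ->
  (p %| x * y)%Z = (p %| x)%Z || (p %| y)%Z.
Proof. by move=> pr; rewrite !dvdzE abszM Euclid_dvdM. Qed.

Lemma dvdz_lens_d_diff (p : nat) (q m n : int) : prime p -> coprimez p q ->
  forall z : int, p%:R * (lens_d p q m - lens_d p q n) = z%:~R ->
  (p %| z)%Z -> (p %| m - n)%Z || (p %| m + n + 1 - q)%Z.
Proof.
move=> pr cpq z Ez pz; have [z' Ez' H] := lens_d_diff m n (prime_gt1 pr) cpq.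
have Ezz' : z = z' by apply/eqP; rewrite -(eqr_int rat) -Ez -Ez'.
rewrite -prime_dvdzM // -[_ * _](subKr (q * z)) Ezz' rpredB //.
by rewrite dvdz_mull // -Ezz'.
Qed.

Lemma Zp_int_eq0 (p : nat) (z : int) : (1 < p)%N ->
  (z%:~R == 0 :> 'Z_p) = (p %| z)%Z.
Proof.
move=> p1; rewrite -val_eqE /= -eqz_nat val_Zp_int //.
by rewrite (sameP eqP dvdz_mod0P).
Qed.

(** Injectivity takes [z = 0]; the vanishing statement only knows that [p] divides [z]. *)
Lemma conj_rel_of_dvdz (p : nat) (q : int) (s t : 'Z_p) : prime p ->
  coprimez p q -> forall z : int,
  p%:R * (spinc_d q t - spinc_d q s) = z%:~R -> (p %| z)%Z -> conj_rel q s t.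
Proof.
move=> pr cpq z Ez pz; have p1 := prime_gt1 pr.
have := dvdz_lens_d_diff pr cpq Ez pz; rewrite -!Zp_int_eq0 //.
rewrite !intrD !intrN -![(Posz (nat_of_ord _))%:~R]/(_%:R) !natr_Zp.
rewrite /conj_rel /spinc_conj subr_eq0 => /orP[-> //|H]; apply/orP; right.
by rewrite -subr_eq0 -(eqP H); apply/eqP; ring.
Qed.

(** * Denominators prime to [p] *)

(** For [p] prime, this is membership in the localization of the integers at [p]. *)
Definition prime_to_denom (p : nat) (x : rat) :=
  exists2 b : nat, coprime p b & x * b%:R \is a Num.int.

Lemma prime_to_denom_int p (a : int) : prime_to_denom p a%:~R.
Proof. by exists 1%N; rewrite ?coprimen1 // mulr1 intr_int. Qed.

Lemma prime_to_denom_div p (x : rat) (b : nat) : (0 < b)%N -> coprime p b ->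
  prime_to_denom p x -> prime_to_denom p (x / b%:R).
Proof.
move=> b0 cpb [a cpa xa]; exists (b * a)%N; first by rewrite coprimeMr cpb.
by rewrite natrM mulrA divfK // pnatr_eq0; lia.
Qed.

Lemma prime_to_denomB p (x y : rat) :
  prime_to_denom p x -> prime_to_denom p y -> prime_to_denom p (x - y).
Proof.
move=> [a cpa xa] [b cpb yb]; exists (a * b)%N; first by rewrite coprimeMr cpa.
have -> : (x - y) * (a * b)%:R = x * a%:R * b%:R - y * b%:R * a%:R.
  by rewrite natrM; ring.
by rewrite rpredB // rpredM // natr_int.
Qed.

(** Each stage of the Euclidean recursion has denominator dividing [4 * a * r] with [a] and [r]
    positive and below [p]. *)
Lemma lens_d_rec_prime_to_denom (p k a r n : nat) : odd p -> prime p ->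
  (r < a < p)%N -> coprime a r -> prime_to_denom p (lens_d_rec k a r n).
Proof.
move=> op pr; have h0 : prime_to_denom p 0 := prime_to_denom_int p 0.
elim: k a r n => [|k IH] a r n /andP[ra ap] car //=; case: ifPn => // a1.
rewrite -ltnNge in a1; have r0 := coprime_gt0r a1 car.
have cop b : (0 < b < p)%N -> coprime p b.
  by case/andP => b0 bp; rewrite prime_coprime // gtnNdvd.
have cp4 : coprime p 4 by rewrite (@coprimeXr 2 p 2) // coprimen2.
apply: prime_to_denomB; last first.
  apply: IH; first by rewrite ltn_mod r0 (ltn_trans ra).
  by rewrite coprime_modr coprime_sym.
rewrite os_rhsE ?pnatr_eq0; [|lia|lia].
apply: prime_to_denomB; last first.
  by apply: (prime_to_denom_div _ cp4) => //; apply: prime_to_denom_int p 1.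
have -> : 4 * a%:R * r%:R = (4 * a * r)%:R :> rat by rewrite !natrM.
apply: prime_to_denom_div; first by lia.
  by rewrite !coprimeMr cp4 !cop //; lia.
have -> : (2 * n%:R + 1 - a%:R - r%:R) ^+ 2 =
    ((2 * n%:Z + 1 - a%:Z - r%:Z) ^+ 2)%:~R :> rat.
  by rewrite rmorphXn /= !intrD !intrN intrM -!pmulrn.
exact: prime_to_denom_int.
Qed.

Lemma lens_d_spin_prime_to_denom (p : nat) (q n : int) : odd p -> prime p ->
  coprimez p q -> (p %| 2 * n + 1 - q)%Z -> prime_to_denom p (lens_d p q n).
Proof.
move=> op pr cpq dvd; have p1 := prime_gt1 pr; have p0 : (0 < p)%N by lia.
have [a ap Ea] := natr_residue q p0; have [b bp Eb] := natr_residue n p0.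
have cpa : coprime p a.
  by rewrite -[coprime p a]/(coprimez p a) -Ea /coprimez gcdz_modr.
have a0 := coprime_gt0r p1 cpa.
have /dvdzP[t Et] : (p %| 2 * b%:Z + 1 - a%:Z)%Z.
  have -> : 2 * b%:Z + 1 - a%:Z =
      (2 * n + 1 - q) - (2 * (n %/ p)%Z - (q %/ p)%Z) * p.
    by rewrite -Ea -Eb {2}(divz_eq n p) {2}(divz_eq q p); ring.
  by rewrite rpredB // dvdz_mull.
have cp4 : coprime p 4 by rewrite (@coprimeXr 2 p 2) // coprimen2.
have E : lens_d p q n = os_rhs p%:R a%:R b%:R - lens_d a p b.
  rewrite lens_d_mod Ea Eb.
  by rewrite -(ct_reciprocity lens_dP _ cpa) ?addrK //; lia.
rewrite E; apply: prime_to_denomB; last first.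
  rewrite /lens_d !modz_nat; apply: lens_d_rec_prime_to_denom => //.
    by rewrite ltn_mod a0.
  by rewrite coprime_modr coprime_sym.
have nzp : p%:R != 0 :> rat by rewrite pnatr_eq0; lia.
have nza : a%:R != 0 :> rat by rewrite pnatr_eq0; lia.
(* By [Et] the numerator is the square of [p * (t - 1)], so the [p] in the denominator [4 * p * a]
   cancels. *)
have -> : os_rhs p%:R a%:R b%:R =
    (p%:Z * (t - 1) ^+ 2)%:~R / (4 * a)%:R - 1%:~R / 4%:R.
  rewrite os_rhsE //.
  have -> : 2 * b%:R + 1 - p%:R - a%:R = (p%:Z * (t - 1))%:~R :> rat.
    have -> : p%:Z * (t - 1) = 2 * b%:Z + 1 - p%:Z - a%:Z by lia.
    by rewrite !intrD !intrN intrM -!pmulrn.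
  by rewrite !expr2 !intrM !natrM intrD intrN -!pmulrn; field; rewrite nzp nza.
apply: prime_to_denomB; apply: prime_to_denom_div => //;
  try exact: prime_to_denom_int; first by lia.
by rewrite coprimeMr cp4 prime_coprime // gtnNdvd.
Qed.

Theorem corollary1p5 (p : nat) (q : int) (p_prime : prime p)
    (pq_coprime : coprimez p q) :
  injective (@spinc_dbar p q) /\
  (odd p -> exists s0 : 'Z_p, unique (from_spin q) s0 /\
     forall s : 'Z_p, spinc_d q s = 0 -> s = s0).
Proof.
have p1 := prime_gt1 p_prime; split=> [x y Exy|op].
  rewrite -[x]reprK -[y]reprK; apply/eqmodP.
  apply: (@conj_rel_of_dvdz p q _ _ p_prime pq_coprime 0) => //.
  by move: Exy; rewrite /spinc_dbar => ->; rewrite subrr mulr0.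
have u2 : (2 : 'Z_p) \is a GRing.unit.
  by rewrite unitZpE // coprime_sym coprime2n.
(* The only solution of [q - 1 - s = s], as 2 is invertible. *)
pose s0 : 'Z_p := (q%:~R - 1) / 2.
have s0E : s0 *+ 2 = q%:~R - 1 by rewrite -mulr_natr divrK.
have spin0 : from_spin q s0 by rewrite /from_spin /spinc_conj -s0E mulr2n addrK.
exists s0; split.
  split=> // s spin_s; apply: (mulIr u2); rewrite !mulr_natr s0E mulr2n.
  by rewrite -{2}spin_s /spinc_conj addrC subrK.
move=> s ds0.
have [b cpb bz] : prime_to_denom p (spinc_d q s0).
  apply: lens_d_spin_prime_to_denom => //; rewrite -Zp_int_eq0 //.
  rewrite intrD intrN intrD intrM -[(Posz s0)%:~R]/(_%:R) natr_Zp.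
  by rewrite [_ * s0]mulr_natl s0E subrK subrr.
have [z Ez _] := lens_d_diff s0 s p1 pq_coprime.
(* Since the term of [s] vanishes, [z] is [p] times that of [s0], whose denominator is prime to
   [p]. *)
have pz : (p %| z)%Z.
  move/intrP: bz => [w Ew].
  have Ezb : z * b%:Z = p%:Z * w.
    apply/eqP; rewrite -(eqr_int rat) !intrM -Ez -Ew -!pmulrn -mulrA.
    by rewrite [lens_d p q s]ds0 subr0.
  have : (p %| z * b%:Z)%Z by rewrite Ezb dvdz_mulr.
  by rewrite Gauss_dvdzl.
(* Either [s0] is [s], or it is the conjugate of [s], and then [s] is the conjugate of the fixed
   point [s0]. *)
have := conj_rel_of_dvdz p_prime pq_coprime Ez pz.
by rewrite /conj_rel => /orP[]/eqP E //; rewrite -[s](spinc_conjK q) -E.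
Qed.
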